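(* Suppose $1<p<q$ with $p,q$ odd and $\gcd(p,q)=1$. Write $q=a_1p+r_1$ with $0<r_1<p$. Let $\ell$ be an odd prime dividing $q$, let $j$ be a positive integer, and set $p'=p+2\ell jr_1$, $q'=q+2\ell ja_1r_1$. Then, for the canonical forms of the polynomials: (1) $\Delta_{K_{p'/q'}}(t)\equiv\Delta_{K_{p/q}}(t)\pmod\ell$ and $\tilde\Delta^\ell_{p'/q'}(t)\equiv\tilde\Delta^\ell_{p/q}(t)\pmod\ell$. (2) If in addition $\gcd(a_1,\ell)=1$, then $$\frac{\tilde\Delta^\ell_{p'/q'}(t)}{\Delta_{K_{p'/q'}}(t)}=\frac{\tilde\Delta^\ell_{p/q}(t)}{\Delta_{K_{p/q}}(t)}.$$
   Context: For odd coprime integers $0<p<q$, $K_{p/q}$ is the corresponding 2-bridge knot and $\epsilon_i=(-1)^{\lfloor ip/q\rfloor}$, $1\le i\le q-1$. The canonical form of its Alexander polynomial is $$\Delta_{K_{p/q}}(t)=1-t^{\epsilon_1}+t^{\epsilon_1+\epsilon_2}-\dots+t^{\epsilon_1+\dots+\epsilon_{q-1}}.$$ For an odd prime $\ell\mid q$ and $\lambda=e^{2\pi i/\ell}$, put $$d_{p/q}(\lambda,t)=\sum_{k=1}^{(q-1)/2}t^{\sum_{j=1}^{2k-1}\epsilon_j}\lambda^{k\epsilon_{2k}},\qquad e_{p/q}(\lambda,t)=1+\sum_{k=1}^{(q-1)/2}t^{\sum_{j=1}^{2k}\epsilon_j}\lambda^{k\epsilon_{2k}}.$$ The canonical form of the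 $\ell$-twisted Alexander polynomial of $K_{p/q}$ is $$\tilde\Delta^\ell_{p/q}(t)=\frac{\Delta_{K_{p/q}}(t)}{t-1}\prod_{i=1}^{\frac{\ell-1}{2}}\frac{d_{p/q}(\lambda^i,t)d_{p/q}(\lambda^{-i},t)-e_{p/q}(\lambda^i,t)e_{p/q}(\lambda^{-i},t)}{t^2-1}.$$ These are Laurent polynomials over $\mathbb Z$ or, a priori, quotients of such by products of powers of $t-1$ and $t+1$; a congruence mod $\ell$ between such quotients means that their difference is $\ell$ times an element of $\mathbb Z[t,t^{-1},(t-1)^{-1},(t+1)^{-1}]$. *)

(* Defs.v *)
From mathcomp Require Import all_boot all_order all_algebra.
From mathcomp Require Import complex reals trigo.

Set Implicit Arguments.
Unset Strict Implicit.
Unset Printing Implicit Defensive.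

Import Order.TTheory GRing.Theory Num.Theory.
Local Open Scope ring_scope.

(* p and q stand for the 2-bridge knot K_{p/q}, 0 < p < q odd and coprime.
   The polynomials below are the explicit canonical representatives, with no
   indeterminacy up to units; all exponents are integers, possibly negative. *)
Definition eps (p q i : nat) : int := (-1) ^+ ((i * p) %/ q)%N.

Definition eps_sum (p q n : nat) : int := \sum_(1 <= j < n.+1) eps p q j.

Section TwoBridgePolynomials.
Variable F : fieldType.
Implicit Types lam t : F.

Definition alexander (p q : nat) t : F :=
  1 + \sum_(1 <= i < q) (-1) ^+ i * t ^ eps_sum p q i.

Definition d_poly (p q : nat) lam t : F :=
  \sum_(1 <= k < (q.-1)./2.+1)
     t ^ eps_sum p q (2 * k).-1 * lam ^ (k%:Z * eps p q (2 * k)).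

Definition e_poly (p q : nat) lam t : F :=
  1 + \sum_(1 <= k < (q.-1)./2.+1)
     t ^ eps_sum p q (2 * k) * lam ^ (k%:Z * eps p q (2 * k)).

Definition twisted_alexander (l p q : nat) lam t : F :=
  alexander p q t / (t - 1) *
  \prod_(1 <= i < (l.-1)./2.+1)
     ((d_poly p q (lam ^+ i) t * d_poly p q (lam ^- i) t
       - e_poly p q (lam ^+ i) t * e_poly p q (lam ^- i) t) / (t ^+ 2 - 1)).

(* For t transcendental over Q, this is membership in the ring
   Z[t, t^-1, (t - 1)^-1, (t + 1)^-1], viewed inside F. *)
Definition in_base_ring t (x : F) : Prop :=
  exists (f : {poly int}) (a b c : nat),
    x = (map_poly intr f).[t] / (t ^+ a * (t - 1) ^+ b * (t + 1) ^+ c).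

Definition congr_mod (l : nat) t (x y : F) : Prop :=
  exists2 z : F, in_base_ring t z & x - y = l%:R * z.

End TwoBridgePolynomials.

Section ComplexRationalFunctions.
Variable R : realType.

Definition ratfun := {fraction {poly R[i]}}.

Definition tvar : ratfun := tofrac 'X.

(* exp(2 pi i / l), as a constant rational function *)
Definition zeta (l : nat) : ratfun :=
  tofrac (cos (2 * pi / l%:R) +i* sin (2 * pi / l%:R))%C%:P.

Definition Delta (p q : nat) : ratfun := alexander p q tvar.

Definition tDelta (l p q : nat) : ratfun :=
  twisted_alexander l p q (zeta l) tvar.

End ComplexRationalFunctions.

Arguments tvar {R}.

(* Main.v *)
From HB Require Import structures.
Require Import Defs.
From mathcomp Require Import all_boot all_order all_algebra.
From mathcomp Require Import complex reals trigo.
From mathcomp Require Import zify ring.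

(** Put m_s = floor(s p / r1). The sign sequence eps_0, ..., eps_(q-1) is the concatenation
over s < r1 of the groups consisting of the sign (-1)^(m_s) followed by m_(s+1) - m_s blocks
of length a1 with alternating signs. Passing from (p, q) to (p', q') keeps a1 and r1 and
inserts, after each group, l j copies of a period (+)^a1 (-)^a1 (up to sign), whose sum is 0.
Hence an inserted period changes no partial sum, and shifts positions by 2 a1. In the
Alexander polynomial the l j copies contribute equal amounts, which gives the congruence.
In d and e they contribute multiples of sum_(m < l j) lambda^(+- a1 m), which vanishes if l
does not divide a1, and is l j otherwise.

The product over lambda^i is integral because it is the value at lambda of an element of
the group ring of Z/l over the base ring Z[t, t^-1, (t-1)^-1, (t+1)^-1] that takes the same
value at all nontrivial l-th roots of unity. *)

Set Implicit Arguments.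
Unset Strict Implicit.
Unset Printing Implicit Defensive.
Import Order.TTheory GRing.Theory Num.Theory.
Local Open Scope ring_scope.

(** * Sign words *)

(* A sign (-1)^b is stored as the boolean b. *)
Definition height (v : seq bool) : int := \sum_(b <- v) (-1) ^+ b.

(* w receives a position, the sign there, and the partial sum including that sign. *)
Fixpoint wsum (V : nmodType) (w : nat -> bool -> int -> V) (x : nat) (c : int)
    (v : seq bool) : V :=
  if v is b :: v' then w x b (c + (-1) ^+ b) + wsum w x.+1 (c + (-1) ^+ b) v'
  else 0.

Lemma height_cat u v : height (u ++ v) = height u + height v.
Proof. by rewrite /height big_cat. Qed.

Lemma height_nseq n b : height (nseq n b) = (-1) ^+ b *+ n.
Proof. by rewrite /height big_nseq iter_addr addr0. Qed.

Lemma wsum_cat (V : nmodType) (w : nat -> bool -> int -> V) x c u v :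
  wsum w x c (u ++ v) =
  wsum w x c u + wsum w (x + size u)%N (c + height u) v.
Proof.
elim: u x c => [|b u IH] x c /=.
  by rewrite add0r addn0 /height big_nil addr0.
by rewrite IH addrA addnS addSn /height big_cons !addrA.
Qed.

Lemma wsum_flatten_nseq (V : nmodType) (w : nat -> bool -> int -> V) x c n v :
  height v = 0 ->
  wsum w x c (flatten (nseq n v)) = \sum_(m < n) wsum w (x + size v * m)%N c v.
Proof.
move=> hv; elim: n x => [|n IH] x; first by rewrite big_ord0.
rewrite /= wsum_cat hv addr0 IH big_ord_recl muln0 addn0; congr (_ + _).
by apply: eq_bigr => m _; rewrite lift0 mulnS addnA.
Qed.

Lemma height_flatten_nseq n v : height v = 0 -> height (flatten (nseq n v)) = 0.
Proof.
move=> hv; elim: n => [|n IH] /=; first by rewrite /height big_nil.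
by rewrite height_cat hv IH addr0.
Qed.

(** The list is produced before the weight and the shift [y], so that one list serves all copies of
    an inserted word and all weights, in particular [root_weight t s mu] for every [mu] at once. *)
Lemma wsum_index x c v : exists L : seq (nat * bool * int),
  forall (V : nmodType) (w : nat -> bool -> int -> V) y,
  wsum w (x + y) c v = \sum_(z <- L) w (z.1.1 + y)%N z.1.2 z.2.
Proof.
elim: v x c => [|b v IH] x c; first by exists [::] => V w y; rewrite big_nil.
have [L hL] := IH x.+1 (c + (-1) ^+ b).
by exists ((x, b, c + (-1) ^+ b) :: L) => V w y; rewrite big_cons -hL.
Qed.

Definition periodic_weight (V : Type) (N : nat) (w : nat -> bool -> int -> V) :=
  forall x y b c, x = y %[mod N] -> w x b c = w y b c.

Lemma wsum_mod (V : nmodType) N (w : nat -> bool -> int -> V) x y c v :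
  periodic_weight N w -> x = y %[mod N] -> wsum w x c v = wsum w y c v.
Proof.
move=> pw; elim: v x y c => //= b v IH x y c xy.
by rewrite (pw _ _ _ _ xy) (IH x.+1 y.+1) // -addn1 -modnDml xy modnDml addn1.
Qed.

(** An inserted power has height 0, so later partial sums are unchanged, and length [n * k],
    divisible by [N], so later positions are unchanged modulo [N]. Only the inserted letters
    contribute something new. The two starting positions drift apart at each insertion; hence they
    are merely assumed congruent. *)
Lemma wsum_insert N k n (g : seq (seq bool * seq bool)) :
  (forall z, z \in g -> size z.2 = k /\ height z.2 = 0) -> (N %| n * k)%N ->
  forall x y c, x = y %[mod N] ->
  exists L : seq (nat * bool * int),
  forall (V : nmodType) (w : nat -> bool -> int -> V), periodic_weight N w ->
  wsum w x c (flatten [seq z.1 ++ flatten (nseq n z.2) | z <- g]) =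
  wsum w y c (flatten [seq z.1 | z <- g]) +
  \sum_(z <- L) \sum_(m < n) w (z.1.1 + k * m)%N z.1.2 z.2.
Proof.
move=> + Nnk; elim: g => [|[u v] g IH] hg x y c xy.
  by exists [::] => V w _; rewrite !big_nil addr0.
have [sv hv] : size v = k /\ height v = 0 by apply: (hg (u, v)); rewrite mem_head.
have [|L2 hL2] := IH (fun z zg => hg z (mem_behead (s := _ :: _) zg))
  (x + size u + n * k)%N (y + size u)%N (c + height u).
  by rewrite -modnDmr (eqP Nnk) addn0 -modnDml xy modnDml.
have [L1 hL1] := wsum_index (x + size u) (c + height u) v.
exists (L1 ++ L2) => V w pw /=.
rewrite big_cat !wsum_cat /= wsum_flatten_nseq // size_cat height_cat.
rewrite height_flatten_nseq // addr0.
have -> : (x + (size u + size (flatten (nseq n v))) = x + size u + n * k)%N.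
  by rewrite size_flatten /shape map_nseq sumn_nseq sv addnA mulnC.
rewrite hL2 // (wsum_mod _ _ pw xy).
under [in LHS]eq_bigr => m _ do rewrite hL1 sv.
by rewrite [\sum_(m < n) \sum_(z <- L1) _]exchange_big /= addrACA !addrA.
Qed.


(** * Groups of the sign word and insertion of periods *)

Definition sign_word (p q n : nat) : seq bool := mkseq (fun i => odd (i * p %/ q)) n.

(** Runs of equal quotient floor(ip/q) have length a or a + 1, and exactly r of the p runs are long.
    A group starts at each long run: the leading letter has the sign of the block after it. *)
Definition group_word (a m n : nat) : seq bool :=
  odd m :: mkseq (fun i => odd (m + i %/ a)) (n * a).

Definition period_word (a m : nat) : seq bool :=
  mkseq (fun i => odd (m + i %/ a)) (2 * a).

Lemma mkseqD T (f : nat -> T) m n :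
  mkseq f (m + n) = mkseq f m ++ mkseq (fun i => f (m + i)%N) n.
Proof. by rewrite /mkseq iotaD map_cat add0n -{2}[m]addn0 iotaDl -map_comp. Qed.

Lemma height_period_word a m : (0 < a)%N -> height (period_word a m) = 0.
Proof.
move=> a0; rewrite /period_word mul2n -addnn mkseqD height_cat.
have -> : mkseq (fun i => odd (m + i %/ a)) a = nseq a (odd m).
  apply: (@eq_from_nth _ false); rewrite size_mkseq ?size_nseq // => i ia.
  by rewrite nth_mkseq // nth_nseq ia divn_small // addn0.
have -> : mkseq (fun i => odd (m + (a + i) %/ a)) a = nseq a (~~ odd m).
  apply: (@eq_from_nth _ false); rewrite size_mkseq ?size_nseq // => i ia.
  rewrite nth_mkseq // nth_nseq ia -{1}[a]mul1n divnMDl // (divn_small ia).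
  by rewrite addn0 addn1.
by rewrite !height_nseq -mulrnDl; case: odd; rewrite ?expr1 ?expr0 ?addNr ?addrN mul0rn.
Qed.

Lemma group_word_odd a m m' n : odd m = odd m' -> group_word a m n = group_word a m' n.
Proof.
move=> mm; rewrite /group_word mm; congr (_ :: _); apply: eq_mkseq => i.
by rewrite !oddD mm.
Qed.

(** The extra blocks continue the alternation. Two of them form a period, and the next period starts
    two quotients later, hence with the same sign. *)
Lemma group_word_insert a m n k : (0 < a)%N ->
  group_word a m (n + 2 * k) =
  group_word a m n ++ flatten (nseq k (period_word a (m + n))).
Proof.
move=> a0; rewrite /group_word mulnDl mkseqD cat_cons; congr (_ :: (_ ++ _)).
elim: k => [|k IH]; first by rewrite muln0.
rewrite mulnS mulnDl mkseqD /= -IH; congr (_ ++ _).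
  by apply: eq_mkseq => i; rewrite divnMDl // addnA.
apply: eq_mkseq => i.
by rewrite !divnMDl // !oddD.
Qed.

(** Put m = floor(sp/r) and i = am + s + u. For u = 0, ip - mq = sp - mr lies in [0, r). For u = 1 +
    va + w with w < a, ip - (m + v)q = (s + 1)p - (m + v)r + wp. This is nonnegative because m + v <
    floor((s + 1)p/r), and below q because sp < (m + 1)r and (w + 1)p <= ap. The truncated [u.-1]
    gives u = 0 and u = 1 the same quotient m. *)
Lemma sign_word_step p q a r s : (0 < a)%N -> q = (a * p + r)%N -> (0 < r)%N -> (r < p)%N ->
  forall u, (u < ((s.+1 * p %/ r - s * p %/ r) * a).+1)%N ->
  ((a * (s * p %/ r) + s + u) * p %/ q)%N = (s * p %/ r + u.-1 %/ a)%N.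
Proof.
move=> a0 -> r0 rp u hu.
set m := (s * p %/ r)%N in hu *; set n := (s.+1 * p %/ r)%N in hu.
have m1 : (m * r <= s * p)%N by rewrite leq_divM.
have m2 : (s * p < m.+1 * r)%N by rewrite ltn_ceil.
have n1 : (n * r <= s.+1 * p)%N by rewrite leq_divM.
have E M x : (M * (a * p + r) <= x)%N -> (x < M.+1 * (a * p + r))%N -> (x %/ (a * p + r))%N = M.
  move=> h1 h2; apply/eqP; rewrite eqn_leq -ltnS ltn_divLR ?h2 ?leq_divRL //; lia.
apply: E; case: u hu => [|u] hu /=; rewrite ?div0n.
- nia.
- have uE := divn_eq u a; have wa := ltn_pmod u a0.
  set v := (u %/ a)%N in uE *; set w := (u %% a)%N in uE wa.
  have vn : (v < n - m)%N by rewrite ltn_divLR.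
  have h : ((m + v) * r <= s.+1 * p)%N.
    by apply: leq_trans n1; rewrite leq_mul2r; apply/orP; right; lia.
  rewrite uE; clear -h; nia.
- nia.
- have uE := divn_eq u a; have wa := ltn_pmod u a0.
  set v := (u %/ a)%N in uE *; set w := (u %% a)%N in uE wa.
  have h1 : (w.+1 * p <= a * p)%N by rewrite leq_mul2r wa orbT.
  have h2 : (s * p < (m + v).+1 * r)%N.
    by apply: leq_trans m2 _; rewrite leq_mul2r ltnS leq_addr ?orbT.
  rewrite uE; clear -h1 h2; nia.
Qed.

Lemma sign_word_groups p q a r : (0 < a)%N -> q = (a * p + r)%N -> (0 < r)%N -> (r < p)%N ->
  sign_word p q q =
  flatten [seq group_word a (s * p %/ r) (s.+1 * p %/ r - s * p %/ r) | s <- iota 0 r].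
Proof.
move=> a0 qE r0 rp.
(* The first t groups have total length a floor(tp/r) + t, which for t = r is ap + r = q. *)
suff H t : sign_word p q (a * (t * p %/ r) + t) = flatten
    [seq group_word a (s * p %/ r) (s.+1 * p %/ r - s * p %/ r) | s <- iota 0 t].
  by rewrite -H mulKn // -qE.
elim: t => [|t IH]; first by rewrite mul0n div0n muln0.
rewrite -addn1 iotaD map_cat flatten_cat -IH /= cats0 addn1.
have le : (t * p %/ r <= t.+1 * p %/ r)%N by rewrite leq_div2r // leq_mul2r leqnSn orbT.
have -> : (a * (t.+1 * p %/ r) + t.+1 =
  a * (t * p %/ r) + t + ((t.+1 * p %/ r - t * p %/ r) * a).+1)%N by nia.
rewrite /sign_word mkseqD; congr (_ ++ _).
apply: (@eq_from_nth _ false); rewrite ?size_mkseq //= ?size_mkseq // => i hi.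
rewrite nth_mkseq // (sign_word_step a0 qE) //; case: i hi => [|i] hi /=.
  by rewrite div0n addn0.
by rewrite nth_mkseq.
Qed.

(** Again q' = ap' + r, and floor(sp'/r) = floor(sp/r) + 2ks. So every group keeps the parity of its
    first quotient and gains 2k blocks at its end, that is, k periods. *)
Lemma sign_word_insert N k p q a r p' q' :
  (0 < a)%N -> q = (a * p + r)%N -> (0 < r)%N -> (r < p)%N ->
  p' = (p + 2 * k * r)%N -> q' = (q + 2 * k * a * r)%N -> (N %| k * (2 * a))%N ->
  exists L : seq (nat * bool * int),
  forall (V : nmodType) (w : nat -> bool -> int -> V), periodic_weight N w ->
  wsum w 0 (-1) (sign_word p' q' q') = wsum w 0 (-1) (sign_word p q q) +
    \sum_(z <- L) \sum_(m < k) w (z.1.1 + 2 * a * m)%N z.1.2 z.2.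
Proof.
move=> a0 qE r0 rp p'E q'E Nk.
pose m s := (s * p %/ r)%N.
pose g := [seq (group_word a (m s) (m s.+1 - m s), period_word a (m s.+1)) | s <- iota 0 r].
have hg z : z \in g -> size z.2 = (2 * a)%N /\ height z.2 = 0.
  by case/mapP=> s _ -> /=; rewrite size_mkseq height_period_word.
have [L hL] := wsum_insert hg Nk (-1) (erefl (0 %% N)%N); exists L => V w pw.
have -> : sign_word p q q = flatten [seq z.1 | z <- g].
  by rewrite (sign_word_groups a0 qE) // -map_comp.
rewrite -hL // (@sign_word_groups p' q' a r) //; last 2 first.
- by rewrite q'E p'E qE; nia.
- by rewrite p'E; nia.
congr (wsum _ _ _ (flatten _)); rewrite -map_comp; apply: eq_map => s /=.
have mE t : (t * p' %/ r = m t + t * (2 * k))%N.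
  by rewrite p'E mulnDr mulnA divnDMl // -mulnA.
rewrite !mE.
have le : (m s <= m s.+1)%N by rewrite leq_div2r // leq_mul2r leqnSn orbT.
rewrite (@group_word_odd a _ (m s)); last by rewrite oddD !oddM andbF addbF.
rewrite (_ : _ - _ = (m s.+1 - m s) + 2 * k)%N; last by rewrite mulSn; lia.
by rewrite group_word_insert // subnKC.
Qed.

(** * Partial sums of the signs *)

Lemma eps_sum0 p q : eps_sum p q 0 = 0.
Proof. by rewrite /eps_sum big_geq. Qed.

Lemma eps_sumS p q n :
  eps_sum p q n.+1 = eps_sum p q n + (-1) ^+ odd (n.+1 * p %/ q).
Proof. by rewrite /eps_sum big_nat_recr //= /eps signr_odd. Qed.

(* The word starts with the sign eps_0 = 1, which eps_sum omits: hence the start at -1. *)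
Lemma wsum_sign_word (V : nmodType) (w : nat -> bool -> int -> V) p q n :
  wsum w 0 (-1) (sign_word p q n.+1) =
  \sum_(0 <= i < n.+1) w i (odd (i * p %/ q)) (eps_sum p q i).
Proof.
(* The height is carried through the induction because it determines the partial sum at the next
   letter. *)
suff H k : height (sign_word p q k.+1) = 1 + eps_sum p q k /\
  wsum w 0 (-1) (sign_word p q k.+1) =
  \sum_(0 <= i < k.+1) w i (odd (i * p %/ q)) (eps_sum p q i) by case: (H n).
elim: k => [|k [IH1 IH2]].
  rewrite big_nat1 /sign_word eps_sum0 /height /= mul0n div0n big_seq1.
  by rewrite mul0n div0n /= expr0 !addr0 addNr.
rewrite /sign_word mkseqS -cats1 height_cat wsum_cat -/(sign_word p q k.+1).
rewrite IH1 IH2 /height big_seq1 [size _]size_mkseq.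
rewrite [\sum_(0 <= i < k.+2) _]big_nat_recr //= add0n addr0.
by rewrite eps_sumS addKr addrA.
Qed.

(** * Values of group ring elements at roots of unity *)

Section GroupRing.
Variables (F : fieldType) (t : F).
Hypotheses (t0 : t != 0) (t1 : t - 1 != 0) (tN1 : t + 1 != 0).

Let base_eval : {poly int} -> F := horner_eval t \o map_poly intr.
HB.instance Definition _ := GRing.RMorphism.copy base_eval
  (horner_eval t \o map_poly (intr : int -> F)).

Let den := t * (t - 1) * (t + 1).

Let den0 : den != 0. Proof. by rewrite !mulf_neq0. Qed.

Variable l : nat.

(* g is given on the l-th roots of unity by an element of the group ring of Z/l
   over the base ring Z[t, t^-1, (t-1)^-1, (t+1)^-1]. *)
Definition in_group_ring (g : F -> F) : Prop :=
  exists (Q : {poly {poly int}}) (n : nat), forall mu, mu ^+ l = 1 ->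
    g mu * den ^+ n = (map_poly base_eval Q).[mu].

(** A constant function can be read off at the trivial root 1, where [Q] takes the value of an
    integer polynomial in t. *)
Lemma in_group_ring_base x : in_group_ring (fun=> x) -> in_base_ring t x.
Proof.
case=> Q [n /(_ 1 (expr1n _ _)) E]; exists Q.[1], n, n, n.
rewrite -[1](rmorph1 base_eval) horner_map /= in E.
by rewrite -!exprMn -[X in X / _]E mulfK ?expf_neq0.
Qed.

Lemma in_group_ring_ext g h : (forall mu, mu ^+ l = 1 -> g mu = h mu) ->
  in_group_ring g -> in_group_ring h.
Proof. by move=> gh [Q [n E]]; exists Q, n => mu hmu; rewrite -gh ?E. Qed.

Lemma in_group_ring_den_exp Q n N : (n <= N)%N ->
  forall g, (forall mu, mu ^+ l = 1 -> g mu * den ^+ n = (map_poly base_eval Q).[mu]) ->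
  exists Q', forall mu, mu ^+ l = 1 -> g mu * den ^+ N = (map_poly base_eval Q').[mu].
Proof.
move=> nN g E; exists (Q * (('X * ('X - 1) * ('X + 1)) ^+ (N - n))%:P) => mu hmu.
rewrite rmorphM hornerM -E // -[RHS]mulrA; congr (_ * _).
have evX : base_eval 'X = t by rewrite /base_eval /= /horner_eval map_polyX hornerX.
rewrite /= map_polyC hornerC -[RHS]/(_ * base_eval _) rmorphXn -{1}(subnKC nN) exprD.
by congr (_ * _ ^+ _); rewrite !rmorphM rmorphB rmorphD rmorph1 /= evX.
Qed.

Lemma in_group_ringD g h : in_group_ring g -> in_group_ring h ->
  in_group_ring (fun mu => g mu + h mu).
Proof.
case=> P [m EP] [Q [n EQ]].
have [P' EP'] := in_group_ring_den_exp (leq_addr n m) EP.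
have [Q' EQ'] := in_group_ring_den_exp (leq_addl m n) EQ.
by exists (P' + Q'), (m + n)%N => mu hmu; rewrite rmorphD hornerD mulrDl EP' ?EQ'.
Qed.

Lemma in_group_ringM g h : in_group_ring g -> in_group_ring h ->
  in_group_ring (fun mu => g mu * h mu).
Proof.
case=> P [m EP] [Q [n EQ]]; exists (P * Q), (m + n)%N => mu hmu.
by rewrite rmorphM hornerM exprD mulrACA EP ?EQ.
Qed.

Lemma in_group_ring_eval f : in_group_ring (fun=> base_eval f).
Proof. by exists f%:P, 0%N => mu _; rewrite map_polyC hornerC mulr1. Qed.

Lemma in_group_ring_int z : in_group_ring (fun=> z%:~R).
Proof.
by apply: in_group_ring_ext (in_group_ring_eval z%:~R) => mu _; rewrite rmorph_int.
Qed.

Lemma in_group_ring0 : in_group_ring (fun=> 0).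
Proof. exact: (in_group_ring_int 0). Qed.

Lemma in_group_ring1 : in_group_ring (fun=> 1).
Proof. exact: (in_group_ring_int 1). Qed.

Lemma in_group_ringN g : in_group_ring g -> in_group_ring (fun mu => - g mu).
Proof.
move=> /(in_group_ringM (in_group_ring_int (-1))).
by apply: in_group_ring_ext => mu _; rewrite mulN1r.
Qed.

Lemma in_group_ringX g n : in_group_ring g -> in_group_ring (fun mu => g mu ^+ n).
Proof.
move=> hg; elim: n => [|n /(in_group_ringM hg)]; first exact: in_group_ring1.
by apply: in_group_ring_ext => mu _; rewrite exprS.
Qed.

Lemma in_group_ring_sum I (r : seq I) g : (forall i, in_group_ring (g i)) ->
  in_group_ring (fun mu => \sum_(i <- r) g i mu).
Proof.
move=> hg; elim: r => [|i r /(in_group_ringD (hg i))].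
  by apply: in_group_ring_ext in_group_ring0 => mu _; rewrite big_nil.
by apply: in_group_ring_ext => mu _; rewrite big_cons.
Qed.

Lemma in_group_ring_prod I (r : seq I) g : (forall i, in_group_ring (g i)) ->
  in_group_ring (fun mu => \prod_(i <- r) g i mu).
Proof.
move=> hg; elim: r => [|i r /(in_group_ringM (hg i))].
  by apply: in_group_ring_ext in_group_ring1 => mu _; rewrite big_nil.
by apply: in_group_ring_ext => mu _; rewrite big_cons.
Qed.

Lemma in_group_ring_t : in_group_ring (fun=> t).
Proof.
apply: in_group_ring_ext (in_group_ring_eval 'X) => mu _.
by rewrite /base_eval /= /horner_eval map_polyX hornerX.
Qed.

Lemma in_group_ring_denV : in_group_ring (fun=> den^-1).
Proof. by exists 1, 1%N => mu _; rewrite rmorph1 hornerC expr1 mulVf. Qed.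

Lemma in_group_ring_expzt z : in_group_ring (fun=> t ^ z).
Proof.
have tV : in_group_ring (fun=> t^-1).
  have T := in_group_ring_t; have O := in_group_ring1.
  have := in_group_ringM (in_group_ringM (in_group_ringD T (in_group_ringN O))
    (in_group_ringD T O)) in_group_ring_denV.
  by apply: in_group_ring_ext => mu _; rewrite /den; field; rewrite t0 t1 tN1.
case: z => n; first exact: in_group_ringX in_group_ring_t.
by apply: in_group_ring_ext (in_group_ringX n.+1 tV) => mu _; rewrite exprVn.
Qed.

Lemma in_group_ring_tB1V : in_group_ring (fun=> (t - 1)^-1).
Proof.
have := in_group_ringM (in_group_ringM in_group_ring_t
  (in_group_ringD in_group_ring_t in_group_ring1)) in_group_ring_denV.
by apply: in_group_ring_ext => mu _; rewrite /den; field; rewrite t0 t1 tN1.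
Qed.

Lemma in_group_ring_tB1D1V : in_group_ring (fun=> (t ^+ 2 - 1)^-1).
Proof.
have := in_group_ringM in_group_ring_t in_group_ring_denV.
apply: in_group_ring_ext => mu _; rewrite /den.
have -> : t ^+ 2 - 1 = (t - 1) * (t + 1) by ring.
by field; rewrite t0 t1 tN1.
Qed.

Hypothesis l_gt0 : (0 < l)%N.

Lemma root_neq0 (mu : F) : mu ^+ l = 1 -> mu != 0.
Proof.
move=> hmu; apply/eqP => mu0; move: hmu; rewrite mu0 expr0n eqn0Ngt l_gt0 /=.
by move/eqP; rewrite eq_sym oner_eq0.
Qed.

Lemma in_group_ring_expz z : in_group_ring (fun mu => mu ^ z).
Proof.
have X : in_group_ring (fun mu => mu).
  by exists 'X, 0%N => mu _; rewrite map_polyX hornerX mulr1.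
case: z => n; first exact: in_group_ringX.
(* On l-th roots of unity inversion is the power l - 1, so negative exponents become polynomial. *)
apply: in_group_ring_ext (in_group_ringX (n.+1 * l.-1) X) => mu hmu.
apply: (mulfI (expf_neq0 n.+1 (root_neq0 hmu))).
rewrite NegzE -exprnN divff ?expf_neq0 ?(root_neq0 hmu) // -exprD.
by rewrite -mulnS prednK // mulnC exprM hmu expr1n.
Qed.

Lemma in_group_ring_comp g i : in_group_ring g -> in_group_ring (fun mu => g (mu ^+ i)).
Proof.
case=> Q [n E]; exists (Q \Po 'X^i), n => mu hmu.
rewrite E; last by rewrite exprAC hmu expr1n.
by rewrite map_comp_poly map_polyXn horner_comp hornerXn.
Qed.

Lemma in_group_ring_compV g : in_group_ring g -> in_group_ring (fun mu => g mu^-1).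
Proof.
move=> /(in_group_ring_comp l.-1); apply: in_group_ring_ext => mu hmu; congr (g _).
by apply: (mulfI (root_neq0 hmu)); rewrite -exprS prednK // hmu divff ?root_neq0.
Qed.

(** * Fourier inversion on the l-th roots of unity *)

Lemma sum_root_expr (mu : F) n : mu ^+ n = 1 -> mu != 1 -> \sum_(i < n) mu ^+ i = 0.
Proof.
move=> hmu mu1; apply: (mulfI (x := mu - 1)); first by rewrite subr_eq0.
by rewrite -subrX1 hmu subrr mulr0.
Qed.

(** Orthogonality of characters: the sum over a of lam^(a(k + b)) is l if l divides k + b, and 0
    otherwise. Only the coefficients in the class of -b survive. *)
Lemma sum_horner_roots (Q : {poly {poly int}}) lam b : l.-primitive_root lam ->
  \sum_(a < l) (map_poly base_eval Q).[lam ^+ a] * lam ^+ (a * b) =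
  l%:R * base_eval (\sum_(k < size Q | (l %| k + b)%N) Q`_k).
Proof.
move=> prim.
under eq_bigr => a _ do rewrite /map_poly horner_poly mulr_suml.
rewrite exchange_big rmorph_sum mulr_sumr /= [RHS]big_mkcond /=.
apply: eq_bigr => k _.
under eq_bigr => a _ do rewrite -mulrA -exprM -exprD -mulnDr mulnC exprM.
rewrite -mulr_sumr; case: ifPn => lk.
  move: lk; rewrite (prim_order_dvd prim) => /eqP ->.
  under eq_bigr => a _ do rewrite expr1n.
  by rewrite sumr_const card_ord mulrC.
rewrite sum_root_expr ?mulr0 //; last by rewrite -(prim_order_dvd prim).
by rewrite exprAC (prim_expr_order prim) expr1n.
Qed.

(* Fourier inversion: with coefficients c_k in the base ring and g equal to g1 on the
   nontrivial roots, l c_0 = g(1) + (l-1) g1 and l c_1 = g(1) - g1. *)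
Lemma in_group_ring_const_base g lam : in_group_ring g -> l.-primitive_root lam ->
  (1 < l)%N -> l%:R != 0 :> F ->
  (forall a, (0 < a < l)%N -> g (lam ^+ a) = g lam) -> in_base_ring t (g lam).
Proof.
case=> Q [n E] prim l1 lF gc.
have lamX a : (lam ^+ a) ^+ l = 1 by rewrite exprAC (prim_expr_order prim) expr1n.
pose c b := \sum_(k < size Q | (l %| k + b)%N) Q`_k.
(* The term at the trivial root is split off; all other values of [g] equal [g lam] and factor out
   of the character sum. *)
have H b : l%:R * base_eval (c b) =
    g 1 * den ^+ n + g lam * den ^+ n * (\sum_(1 <= a < l) lam ^+ (a * b)).
  rewrite -(sum_horner_roots _ _ prim) -(big_mkord xpredT
    (fun a => (map_poly base_eval Q).[lam ^+ a] * lam ^+ (a * b))).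
  rewrite big_ltn // mul0n !expr0 mulr1 -E ?expr1n //; congr (_ + _).
  rewrite mulr_sumr big_nat_cond [RHS]big_nat_cond; apply: eq_bigr => a.
  by rewrite andbT => al; rewrite -E // gc.
have S b : \sum_(1 <= a < l) lam ^+ (a * b) = (\sum_(a < l) (lam ^+ b) ^+ a) - 1.
  rewrite -(big_mkord xpredT (fun a => (lam ^+ b) ^+ a)) big_ltn // expr0 addrC addKr.
  by apply: eq_bigr => a _; rewrite mulnC exprM.
have H0 := H 0%N; have H1 := H 1%N.
have lam1 : lam != 1 by rewrite -[lam]expr1 -(prim_order_dvd prim) dvdn1 gtn_eqF.
rewrite S (sum_root_expr (prim_expr_order prim) lam1) ?expr1 in H1.
move: H0; rewrite S expr0; under eq_bigr => a _ do rewrite expr1n.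
rewrite sumr_const card_ord => H0.
(* Subtracting [H1] from [H0] cancels the unknown value g(1) and leaves l g(lam) den^n, from which l
   is cancelled. *)
exists (c 0%N - c 1%N), n, n, n; rewrite -!exprMn -/den.
apply: (mulIf (expf_neq0 n den0)); rewrite mulfVK ?expf_neq0 //.
apply: (mulfI lF); rewrite -[(map_poly _ _).[_]]/(base_eval _) rmorphB mulrBr H0 H1.
by ring.
Qed.

End GroupRing.

(* As in Gauss's lemma, multiplication by a permutes the classes modulo l up to sign. *)
Lemma prod_half_system (F : comNzRingType) (f : nat -> F) l a : odd l -> coprime a l ->
  (forall x y, x = y %[mod l] -> f x = f y) ->
  (forall x y, (l %| x + y)%N -> f x = f y) ->
  \prod_(1 <= i < l.-1./2.+1) f (a * i)%N = \prod_(1 <= i < l.-1./2.+1) f i.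
Proof.
move=> lodd cop fmod fopp; set h := l.-1./2.
have lE : l = (2 * h).+1 by rewrite /h; lia.
pose r (i : 'I_h) := ((a * i.+1) %% l)%N.
have nz i : r i != 0%N.
  rewrite -/(dvdn _ _) Gauss_dvdr 1?coprime_sym // gtnNdvd //.
  by have := ltn_ord i; lia.
have rl i : (r i < l)%N by rewrite ltn_mod; lia.
(* [s i] is the representative up to sign, in 1..h, of a(i + 1) modulo l; ordinals start at 0, hence
   the shift by one. Once [s] is injective it permutes 1..h. *)
pose s (i : 'I_h) := (if (r i <= h)%N then r i else l - r i)%N.
have sP i : (0 < s i <= h)%N.
  by have := nz i; have := rl i; rewrite /s; case: (leqP (r i) h); lia.
have sh i : ((s i).-1 < h)%N by have := sP i; lia.
have sE i : s i = r i \/ (s i + r i = l)%N.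
  by have := rl i; rewrite /s; case: (leqP (r i) h); lia.
have s_inj : injective (fun i => Ordinal (sh i)).
  move=> i j /(congr1 val) /= eqs.
  have {}eqs : s i = s j by have := sP i; have := sP j; lia.
  have : r i = r j \/ (r i + r j = l)%N.
    by have := sE i; have := sE j; have := rl i; have := rl j; rewrite eqs; lia.
  case=> [eqr|addr].
  + apply: val_inj => /=; move: eqr; rewrite /r.
    wlog ij : i j {eqs} / (i <= j)%N.
      by move=> W; case: (leqP i j) => [/W//|/ltnW ji /esym]; move/(W _ _ ji) => ->.
    move/eqP; rewrite eq_sym eqn_mod_dvd ?leq_mul2l ?ltnS ?ij ?orbT //.
    rewrite -mulnBr Gauss_dvdr 1?coprime_sym // subSS => d.
    have [|] := posnP (j - i); first by lia.
    move=> /dvdn_leq /(_ d); have := ltn_ord j; lia.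
  (* Opposite residues cannot occur: l would divide (i + 1) + (j + 1), which lies between 2 and 2h =
     l - 1. *)
  + have : (l %| a * i.+1 + a * j.+1)%N by rewrite /dvdn -modnDm -/(r i) -/(r j) addr modnn.
    rewrite -mulnDr Gauss_dvdr 1?coprime_sym // => /dvdn_leq -/(_ isT).
    by have := ltn_ord i; have := ltn_ord j; lia.
rewrite !big_add1 /= !big_mkord [RHS](reindex_inj s_inj); apply: eq_bigr => i _ /=.
rewrite prednK; last by case/andP: (sP i).
case: (sE i) => [->|e]; first by apply: fmod; rewrite modn_mod.
by apply: fopp; rewrite /dvdn -modnDml addnC e modnn.
Qed.

(** * Effect of the insertion on the polynomials *)

Section Weights.
Variables (F : fieldType) (t : F).

Definition alexander_weight (x : nat) (b : bool) (c : int) : F := (-1) ^+ x * t ^ c.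

(** One weight for both sums: only positions x = 2k count, and [s] chooses the exponent of t. For e
    it is the partial sum up to 2k; for d it is the sum up to 2k - 1, obtained by removing the
    current sign. *)
Definition root_weight (s : bool -> int -> int) (mu : F) (x : nat) (b : bool) (c : int) : F :=
  if odd x then 0 else t ^ s b c * mu ^ (x./2%:Z * (-1) ^+ b).

Let e_weight := root_weight (fun _ c => c).
Let d_weight := root_weight (fun b c => c - (-1) ^+ b).

Lemma alexander_wsum p q : (0 < q)%N ->
  alexander p q t = wsum alexander_weight 0 (-1) (sign_word p q q).
Proof.
case: q => // q _; rewrite wsum_sign_word /alexander [RHS]big_ltn //.
by rewrite /alexander_weight eps_sum0 expr0 mulr1.
Qed.

Lemma sum_even (V : nmodType) (g : nat -> V) h :
  \sum_(0 <= i < (2 * h).+1) (if odd i then 0 else g i) = \sum_(0 <= k < h.+1) g (2 * k)%N.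
Proof.
elim: h => [|h IH]; first by rewrite !big_nat1.
rewrite mulnS big_nat_recr // big_nat_recr // IH [RHS]big_nat_recr //=.
by rewrite mul2n odd_double addr0 -mul2n mulnS.
Qed.

Lemma e_poly_wsum p q mu : odd q ->
  e_poly p q mu t = wsum (e_weight mu) 0 (-1) (sign_word p q q).
Proof.
move=> qodd; have qE : q = (2 * (q.-1)./2).+1 by lia.
rewrite {3}qE wsum_sign_word -qE.
rewrite {2}qE sum_even big_ltn // /e_poly; congr (_ + _).
  by rewrite muln0 eps_sum0 mul0r mulr1.
by apply: eq_bigr => k _; rewrite /eps signr_odd mul2n doubleK.
Qed.

(* t^-1 is the term k = 0, absent from d_poly. *)
Lemma d_poly_wsum p q mu : odd q ->
  d_poly p q mu t = wsum (d_weight mu) 0 (-1) (sign_word p q q) - t^-1.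
Proof.
move=> qodd; have qE : q = (2 * (q.-1)./2).+1 by lia.
rewrite {3}qE wsum_sign_word -qE.
rewrite {2}qE sum_even big_ltn // muln0 mul0n div0n eps_sum0.
rewrite expr0 mul0r mulr1 sub0r addrC addKr /d_poly.
apply: eq_big_nat => -[//|k] _; rewrite /eps signr_odd mul2n doubleK.
by rewrite doubleS [in RHS]eps_sumS signr_odd addrK.
Qed.

Lemma alexander_weight_periodic (N : nat) : periodic_weight (2 * N)%N alexander_weight.
Proof.
move=> x y b c xy; rewrite /alexander_weight -signr_odd -[(-1) ^+ y]signr_odd.
by rewrite -(@odd_mod x (2 * N)) ?oddM // xy odd_mod ?oddM.
Qed.

Lemma expz_sign (mu : F) (k : nat) b : mu ^ (k%:Z * (-1) ^+ b) = (mu ^ ((-1) ^+ b)) ^+ k.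
Proof. by rewrite mulrC -exprz_exp. Qed.

Lemma root_expz l (mu : F) (z : int) : mu ^+ l = 1 -> (mu ^ z) ^+ l = 1.
Proof. by move=> hmu; rewrite exprnP exprz_exp mulrC -exprz_exp -exprnP hmu exp1rz. Qed.

Lemma root_weight_periodic s (l : nat) mu :
  mu ^+ l = 1 -> periodic_weight (2 * l)%N (root_weight s mu).
Proof.
move=> hmu x y b c xy; rewrite /root_weight.
have -> : odd x = odd y by rewrite -(@odd_mod x (2 * l)) ?oddM // xy odd_mod ?oddM.
case: odd => //; congr (_ * _).
have hxy : (x./2 %% l = y./2 %% l)%N by rewrite -!divn2 !modn_divl ![(_ * 2)%N]mulnC xy.
rewrite !expz_sign -[LHS](expr_mod _ (root_expz ((-1) ^+ b) hmu)) hxy expr_mod //.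
exact: root_expz.
Qed.

Lemma sum_alexander_weight n a x b c :
  \sum_(m < n) alexander_weight (x + 2 * a * m) b c = n%:R * alexander_weight x b c.
Proof.
rewrite /alexander_weight (eq_bigr (fun=> (-1) ^+ x * t ^ c)); last first.
  by move=> m _; rewrite exprD -mulnA exprM sqrrN !expr1n mulr1.
by rewrite sumr_const card_ord mulr_natl.
Qed.

(** A shift by 2a preserves parity and adds a to half the position, so the copies form a geometric
    progression of ratio mu^a or mu^(-a). *)
Lemma sum_root_weight s mu n a x b c :
  \sum_(m < n) root_weight s mu (x + 2 * a * m) b c =
  root_weight s mu x b c * \sum_(m < n) ((mu ^ ((-1) ^+ b)) ^+ a) ^+ m.
Proof.
rewrite /root_weight mulr_sumr; apply: eq_bigr => m _.
rewrite -mulnA mul2n oddD odd_double addbF; case: ifP => ox; first by rewrite mul0r.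
by rewrite halfD odd_double andbF add0n doubleK !expz_sign exprD -exprM mulrA.
Qed.

Lemma expr_coprime_eq1 (mu : F) m n : coprime m n -> (0 < n)%N ->
  mu ^+ m = 1 -> mu ^+ n = 1 -> mu = 1.
Proof.
move=> cop n0 hm hn; have [k prim kn] := prim_order_exists n0 hn.
have km : (k %| m)%N by rewrite (prim_order_dvd prim) hm.
have : (k %| gcdn m n)%N by rewrite dvdn_gcd km.
rewrite (eqP cop) dvdn1 => /eqP k1; rewrite k1 in prim.
exact: prim_expr_order prim.
Qed.

(** The ratio is an l-th root of unity, and it is not 1 because a is prime to l, so the geometric
    sum over l j terms vanishes. *)
Lemma sum_root_weight_coprime s (l j : nat) mu a x b c : coprime a l -> (0 < l)%N ->
  mu ^+ l = 1 -> mu != 1 ->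
  \sum_(m < l * j) root_weight s mu (x + 2 * a * m) b c = 0.
Proof.
move=> cop l0 hmu mu1; rewrite sum_root_weight sum_root_expr ?mulr0 //.
  by rewrite -exprM mulnCA exprM root_expz // expr1n.
apply: contraNneq mu1 => h.
have h1 := expr_coprime_eq1 cop l0 h (root_expz _ hmu).
by rewrite -[mu]expr1z -(signrMK b 1) -exprz_exp mulr1 h1 exp1rz.
Qed.

Lemma sum_root_weight_dvd s (l j : nat) mu a x b c : (l %| a)%N -> mu ^+ l = 1 ->
  \sum_(m < l * j) root_weight s mu (x + 2 * a * m) b c =
  l%:R * (j%:R * root_weight s mu x b c).
Proof.
move=> /dvdnP[k ->] hmu; rewrite sum_root_weight.
have -> : (mu ^ ((-1) ^+ b)) ^+ (k * l) = 1 by rewrite mulnC exprM root_expz // expr1n.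
under eq_bigr => m _ do rewrite expr1n.
by rewrite sumr_const card_ord mulrA -natrM mulrC.
Qed.

End Weights.

Section Insertion.
Variables (F : fieldType) (t : F).
Hypotheses (t0 : t != 0) (t1 : t - 1 != 0) (tN1 : t + 1 != 0).
Variables (l p q a r j p' q' : nat).
Hypotheses (l_gt0 : (0 < l)%N) (a_gt0 : (0 < a)%N) (qE : q = (a * p + r)%N).
Hypotheses (r_gt0 : (0 < r)%N) (rp : (r < p)%N) (qodd : odd q).
Hypotheses (p'E : p' = (p + 2 * l * j * r)%N) (q'E : q' = (q + 2 * l * j * a * r)%N).

Let q'odd : odd q'. Proof. by rewrite q'E oddD qodd -!mulnA oddM. Qed.

(** Each insertion of l j periods of length 2a displaces later letters by 2l(ja), a multiple of 2l,
    which is a period of all the weights. *)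
Let insert : exists L : seq (nat * bool * int),
  forall w : nat -> bool -> int -> F, periodic_weight (2 * l)%N w ->
  wsum w 0 (-1) (sign_word p' q' q') = wsum w 0 (-1) (sign_word p q q) +
    \sum_(z <- L) \sum_(m < l * j) w (z.1.1 + 2 * a * m)%N z.1.2 z.2.
Proof.
have [|||L hL] := @sign_word_insert (2 * l) (l * j) p q a r p' q' a_gt0 qE r_gt0 rp.
- by rewrite p'E mulnA.
- by rewrite q'E !mulnA.
- by apply/dvdnP; exists (j * a)%N; ring.
by exists L; apply: hL.
Qed.

Lemma in_group_ring_root_weight s x b c :
  in_group_ring t l (fun mu => root_weight t s mu x b c).
Proof.
rewrite /root_weight; case: odd; first exact: in_group_ring0.
by apply: in_group_ringM; [apply: in_group_ring_expzt | apply: in_group_ring_expz].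
Qed.

Lemma in_group_ring_wsum_root_weight s x c v :
  in_group_ring t l (fun mu => wsum (root_weight t s mu) x c v).
Proof.
elim: v x c => [|b v IH] x c /=; first exact: in_group_ring0.
by apply: in_group_ringD => //; apply: in_group_ring_root_weight.
Qed.

Lemma alexander_insert : exists2 x, in_group_ring t l (fun=> x) &
  alexander p' q' t - alexander p q t = l%:R * x.
Proof.
have [L hL] := insert.
exists (\sum_(z <- L) j%:R * alexander_weight t z.1.1 z.1.2 z.2).
  apply: in_group_ring_sum => // z; apply: in_group_ringM => //.
    exact: (in_group_ring_int t l j).
  apply: in_group_ringM => //; last exact: in_group_ring_expzt.
  by apply: in_group_ringX => //; apply: (in_group_ring_int t l (-1)).
rewrite !alexander_wsum ?odd_gt0 // hL; last exact: alexander_weight_periodic.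
rewrite [LHS]addrC addKr mulr_sumr; apply: eq_bigr => z _.
by rewrite sum_alexander_weight natrM mulrA.
Qed.

Lemma wsum_insert_coprime s mu : coprime a l -> mu ^+ l = 1 -> mu != 1 ->
  wsum (root_weight t s mu) 0 (-1) (sign_word p' q' q') =
  wsum (root_weight t s mu) 0 (-1) (sign_word p q q).
Proof.
move=> cop hmu mu1; have [L hL] := insert.
rewrite hL ?big1 ?addr0 //; last exact: root_weight_periodic.
by move=> z _; rewrite sum_root_weight_coprime.
Qed.

(** Here the geometric ratio is 1. A single [h] works at all l-th roots, including 1, so the
    congruence holds in the group ring and can be multiplied there before specialising to [lam]. *)
Lemma wsum_insert_dvd s : (l %| a)%N -> exists2 h, in_group_ring t l h &
  forall mu, mu ^+ l = 1 -> wsum (root_weight t s mu) 0 (-1) (sign_word p' q' q') =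
  wsum (root_weight t s mu) 0 (-1) (sign_word p q q) + l%:R * h mu.
Proof.
move=> la; have [L hL] := insert.
exists (fun mu => \sum_(z <- L) j%:R * root_weight t s mu z.1.1 z.1.2 z.2).
  apply: in_group_ring_sum => // z; apply: in_group_ringM => //.
    exact: (in_group_ring_int t l j).
  exact: in_group_ring_root_weight.
move=> mu hmu; rewrite hL; last exact: root_weight_periodic.
by rewrite mulr_sumr; congr (_ + _); apply: eq_bigr => z _; rewrite sum_root_weight_dvd.
Qed.

End Insertion.

(** * The twisted Alexander polynomial *)

Section Twisted.
Variables (F : fieldType) (t : F).
Hypotheses (t0 : t != 0) (t1 : t - 1 != 0) (tN1 : t + 1 != 0).
Variable l : nat.
Hypotheses (lprime : prime l) (lodd : odd l) (lF : l%:R != 0 :> F).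

Let l_gt0 : (0 < l)%N. Proof. exact: prime_gt0. Qed.

Definition twisted_factor p q (mu : F) : F :=
  (d_poly p q mu t * d_poly p q mu^-1 t - e_poly p q mu t * e_poly p q mu^-1 t)
  / (t ^+ 2 - 1).

Definition twisted_product p q (mu : F) : F :=
  \prod_(1 <= i < (l.-1)./2.+1) twisted_factor p q (mu ^+ i).

Lemma twisted_alexanderE p q lam :
  twisted_alexander l p q lam t = alexander p q t / (t - 1) * twisted_product p q lam.
Proof. by []. Qed.

Lemma in_group_ring_d_poly p q : odd q -> in_group_ring t l (fun mu => d_poly p q mu t).
Proof.
move=> qodd; have := in_group_ringD (in_group_ring_wsum_root_weight t0 t1 tN1 l_gt0
  (fun b c => c - (-1) ^+ b) 0 (-1) (sign_word p q q))
  (in_group_ringN (in_group_ring_expzt t0 t1 tN1 l (-1))).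
by apply: in_group_ring_ext => mu _; rewrite d_poly_wsum.
Qed.

Lemma in_group_ring_e_poly p q : odd q -> in_group_ring t l (fun mu => e_poly p q mu t).
Proof.
move=> qodd; have := in_group_ring_wsum_root_weight t0 t1 tN1 l_gt0
  (fun _ c => c) 0 (-1) (sign_word p q q).
by apply: in_group_ring_ext => mu _; rewrite e_poly_wsum.
Qed.

Lemma in_group_ring_twisted_factor p q : odd q -> in_group_ring t l (twisted_factor p q).
Proof.
move=> qodd; have D := in_group_ring_d_poly p qodd; have E := in_group_ring_e_poly p qodd.
apply: in_group_ringM (in_group_ring_tB1D1V t0 t1 tN1 l).
apply: in_group_ringD => //; last apply: in_group_ringN.
  by apply: (in_group_ringM D); apply: (in_group_ring_compV l_gt0 D).
by apply: (in_group_ringM E); apply: (in_group_ring_compV l_gt0 E).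
Qed.

Lemma in_group_ring_twisted_product p q : odd q -> in_group_ring t l (twisted_product p q).
Proof.
move=> qodd; apply: in_group_ring_prod => i; apply: in_group_ring_comp.
exact: in_group_ring_twisted_factor.
Qed.

Lemma twisted_factorV p q mu : twisted_factor p q mu^-1 = twisted_factor p q mu.
Proof.
by rewrite /twisted_factor invrK [X in X - _]mulrC [X in _ - X]mulrC.
Qed.

(** Galois invariance: multiplication by a permutes the exponents 1..(l - 1)/2 up to sign modulo l,
    and a factor does not change under inversion of its root. This is the constancy that
    [in_group_ring_const_base] requires. *)
Lemma twisted_product_expr p q lam a : lam ^+ l = 1 -> (0 < a < l)%N ->
  twisted_product p q (lam ^+ a) = twisted_product p q lam.
Proof.
move=> hlam /andP[a0 al]; rewrite /twisted_product.
under eq_bigr => i _ do rewrite -exprM.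
apply: (prod_half_system (f := fun i => twisted_factor p q (lam ^+ i))) => //.
- by rewrite coprime_sym prime_coprime // gtnNdvd.
- by move=> x y xy; rewrite -(expr_mod _ hlam) xy expr_mod.
- move=> x y /dvdnP[k xy]; rewrite -twisted_factorV; congr twisted_factor.
  apply: (mulfI (expf_neq0 x (root_neq0 l_gt0 hlam))).
  by rewrite divff ?expf_neq0 ?(root_neq0 l_gt0 hlam) // -exprD xy mulnC exprM hlam expr1n.
Qed.

Variables (p q a r j p' q' : nat).
Hypotheses (a_gt0 : (0 < a)%N) (qE : q = (a * p + r)%N).
Hypotheses (r_gt0 : (0 < r)%N) (rp : (r < p)%N) (qodd : odd q).
Hypotheses (p'E : p' = (p + 2 * l * j * r)%N) (q'E : q' = (q + 2 * l * j * a * r)%N).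
Variable lam : F.
Hypothesis prim : l.-primitive_root lam.

Let q'odd : odd q'. Proof. by rewrite q'E oddD qodd -!mulnA oddM. Qed.

Let lam_l : lam ^+ l = 1. Proof. exact: prim_expr_order. Qed.

Lemma twisted_product_coprime : coprime a l ->
  twisted_product p' q' lam = twisted_product p q lam.
Proof.
move=> cop.
have H s mu : mu ^+ l = 1 -> mu != 1 ->
    wsum (root_weight t s mu) 0 (-1) (sign_word p' q' q') =
    wsum (root_weight t s mu) 0 (-1) (sign_word p q q).
  exact: (wsum_insert_coprime t l_gt0 a_gt0 qE r_gt0 rp p'E q'E).
apply: eq_big_nat => i /andP[i0 il].
have m1 : (lam ^+ i) ^+ l = 1 by rewrite exprAC lam_l expr1n.
have mn1 : lam ^+ i != 1 by rewrite -(prim_order_dvd prim) gtnNdvd //; lia.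
have v1 : (lam ^+ i)^-1 ^+ l = 1 by rewrite exprVn m1 invr1.
have vn1 : (lam ^+ i)^-1 != 1 by rewrite invr_eq1.
by rewrite /twisted_factor !d_poly_wsum // !e_poly_wsum // !H.
Qed.

(** Congruence modulo l in the group ring. A single factor at [lam] has coefficients involving
    [lam], so the descent to the base ring waits for the whole product. *)
Let congr_gr (g' g : F -> F) := exists2 h, in_group_ring t l h &
  forall mu, mu ^+ l = 1 -> g' mu = g mu + l%:R * h mu.

Let congr_grM g' g h' h : in_group_ring t l g' -> in_group_ring t l h ->
  congr_gr g' g -> congr_gr h' h -> congr_gr (fun mu => g' mu * h' mu) (fun mu => g mu * h mu).
Proof.
move=> hg' hh [x hx gE] [y hy hE].
(* From g'h' - gh = g'(h' - h) + (g' - g)h. *)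
exists (fun mu => g' mu * y mu + x mu * h mu).
  by apply: in_group_ringD => //; apply: in_group_ringM.
by move=> mu hmu; rewrite hE // mulrDr (gE mu) //; ring.
Qed.

Lemma twisted_product_dvd : (l %| a)%N -> congr_gr (twisted_product p' q') (twisted_product p q).
Proof.
move=> la.
have H s := wsum_insert_dvd t0 t1 tN1 l_gt0 a_gt0 qE r_gt0 rp p'E q'E s la.
have cV g' g : congr_gr g' g -> congr_gr (fun mu => g' mu^-1) (fun mu => g mu^-1).
  case=> h hh E; exists (fun mu => h mu^-1); first exact: in_group_ring_compV.
  by move=> mu hmu; rewrite E // exprVn hmu invr1.
have cD : congr_gr (fun mu => d_poly p' q' mu t) (fun mu => d_poly p q mu t).
  have [h hh E] := H (fun b c => c - (-1) ^+ b); exists h => // mu hmu.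
  by rewrite !d_poly_wsum // E // addrAC.
have cE : congr_gr (fun mu => e_poly p' q' mu t) (fun mu => e_poly p q mu t).
  have [h hh E] := H (fun _ c => c); exists h => // mu hmu.
  by rewrite !e_poly_wsum // E.
have [x hx xE] := congr_grM (in_group_ring_d_poly p' q'odd)
  (in_group_ring_compV l_gt0 (in_group_ring_d_poly p qodd)) cD (cV _ _ cD).
have [y hy yE] := congr_grM (in_group_ring_e_poly p' q'odd)
  (in_group_ring_compV l_gt0 (in_group_ring_e_poly p qodd)) cE (cV _ _ cE).
have cF i : congr_gr (fun mu => twisted_factor p' q' (mu ^+ i))
    (fun mu => twisted_factor p q (mu ^+ i)).
  exists (fun mu => (x (mu ^+ i) - y (mu ^+ i)) / (t ^+ 2 - 1)).
    apply: in_group_ringM (in_group_ring_tB1D1V t0 t1 tN1 l).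
    apply: in_group_ringD => //; last apply: in_group_ringN.
      exact: in_group_ring_comp hx.
    exact: in_group_ring_comp hy.
  move=> mu hmu; have mui : (mu ^+ i) ^+ l = 1 by rewrite exprAC hmu expr1n.
  by rewrite /twisted_factor xE // yE //; ring.
rewrite /twisted_product; elim: (index_iota _ _) => [|i s [h hh E]].
  exists (fun=> 0); first exact: in_group_ring0.
  by move=> mu _; rewrite !big_nil mulr0 addr0.
have G P Q : odd Q -> in_group_ring t l (fun mu => twisted_factor P Q (mu ^+ i)).
  by move=> Qodd; apply: in_group_ring_comp; apply: in_group_ring_twisted_factor.
have Gs : in_group_ring t l (fun mu => \prod_(i <- s) twisted_factor p q (mu ^+ i)).
  by apply: in_group_ring_prod => k; apply: in_group_ring_comp; apply: in_group_ring_twisted_factor.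
have [z hz zE] := congr_grM (G _ _ q'odd) Gs (cF i) (ex_intro2 _ _ h hh E).
by exists z => // mu hmu; rewrite !big_cons zE.
Qed.

Lemma in_group_ring_alexander P Q : odd Q -> in_group_ring t l (fun=> alexander P Q t).
Proof.
move=> Qodd; apply: in_group_ring_ext (fun _ _ => esym (alexander_wsum t P (odd_gt0 Qodd))) _.
elim: (sign_word _ _ _) 0%N (-1) => [|b v IH] x c /=; first exact: in_group_ring0.
apply: in_group_ringD => //; apply: in_group_ringM; last exact: in_group_ring_expzt.
by apply: in_group_ringX => //; apply: (in_group_ring_int t l (-1)).
Qed.

Lemma alexander_congr : congr_mod l t (alexander p' q' t) (alexander p q t).
Proof.
have [x hx E] := alexander_insert t0 t1 tN1 a_gt0 qE r_gt0 rp qodd p'E q'E.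
by exists x => //; apply: in_group_ring_base hx.
Qed.

Lemma twisted_alexander_congr :
  congr_mod l t (twisted_alexander l p' q' lam t) (twisted_alexander l p q lam t).
Proof.
have [x hx E] := alexander_insert t0 t1 tN1 a_gt0 qE r_gt0 rp qodd p'E q'E.
have l1 := prime_gt1 lprime.
have base g : in_group_ring t l g ->
    (forall b, (0 < b < l)%N -> g (lam ^+ b) = g lam) -> in_base_ring t (g lam).
  by move=> hg; apply: in_group_ring_const_base.
have tV := in_group_ring_tB1V t0 t1 tN1 l.
have P0 := in_group_ring_twisted_product p qodd.
rewrite !twisted_alexanderE.
have [cop | ncop] := boolP (coprime l a).
  rewrite twisted_product_coprime 1?coprime_sym //.
  (* The twisted product is unchanged, so only the Alexander factor contributes to the
     difference. *)
  exists (x / (t - 1) * twisted_product p q lam); last by rewrite -mulrBl -mulrBl E !mulrA.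
  apply: (base (fun mu => x / (t - 1) * twisted_product p q mu)).
    by apply: in_group_ringM => //; apply: in_group_ringM.
  by move=> b hb; rewrite twisted_product_expr.
have la : (l %| a)%N by rewrite prime_coprime // negbK in ncop.
have [h hh hE] := twisted_product_dvd la.
have A := in_group_ring_alexander p' q'odd.
(* Both factors change now, and the difference of products is split as in [congr_grM]. *)
exists (alexander p' q' t / (t - 1) * h lam + x / (t - 1) * twisted_product p q lam); last first.
  by rewrite hE // mulrDr; move: E => /eqP; rewrite subr_eq => /eqP ->; ring.
apply: (base (fun mu => alexander p' q' t / (t - 1) * h mu + x / (t - 1) * twisted_product p q mu)).
  by apply: in_group_ringD => //; apply: in_group_ringM => //; apply: in_group_ringM.
move=> b hb; rewrite twisted_product_expr //; congr (_ * _ + _).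
have lb : (lam ^+ b) ^+ l = 1 by rewrite exprAC lam_l expr1n.
(* l h is the difference of two products, each constant on the nontrivial roots; since l is nonzero
   in [F], [h] is constant there too. *)
apply: (mulfI lF); apply: (addrI (twisted_product p q lam)).
by rewrite -hE // -[in LHS](twisted_product_expr p q lam_l hb) -hE // twisted_product_expr.
Qed.

Lemma twisted_alexander_ratio : coprime a l ->
  alexander p q t != 0 -> alexander p' q' t != 0 ->
  twisted_alexander l p' q' lam t / alexander p' q' t =
  twisted_alexander l p q lam t / alexander p q t.
Proof.
move=> cop x0 y0; rewrite !twisted_alexanderE twisted_product_coprime //.
by field; rewrite ?x0 ?y0 ?t1.
Qed.

End Twisted.

(** * Nonvanishing of the Alexander polynomial *)

(** The value at t = 1 of a Laurent polynomial: clearing negative exponents by t^N does not affect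
    it. *)
Definition laurent_at1 (R : realType) (x : ratfun R) (v : R[i]) : Prop :=
  exists (N : nat) (f : {poly R[i]}), x * tvar ^+ N = tofrac f /\ f.[1] = v.

Lemma laurent_at1D (R : realType) (x y : ratfun R) u v :
  laurent_at1 x u -> laurent_at1 y v -> laurent_at1 (x + y) (u + v).
Proof.
move=> [M [f [fE fu]]] [N [g [gE gv]]]; exists (M + N)%N, (f * 'X^N + g * 'X^M).
rewrite !hornerE !expr1n fu gv !mulr1; split=> //.
by rewrite fraction.tofracD !fraction.tofracM -fE -gE !fraction.tofracXn exprD -!/tvar; ring.
Qed.

Lemma laurent_at1_sum (R : realType) (s : seq nat) (e : nat -> int) :
  laurent_at1 (\sum_(i <- s) (-1) ^+ i * tvar ^ e i : ratfun R) (\sum_(i <- s) (-1) ^+ i).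
Proof.
elim: s => [|i s IH]; first by exists 0%N, 0; rewrite !big_nil mul0r rmorph0 horner0.
rewrite !big_cons; apply: laurent_at1D => //.
have t0 : tvar != 0 :> ratfun R by rewrite fraction.tofrac_eq0 polyX_eq0.
case: (e i) => n.
  exists 0%N, ((-1) ^+ i * 'X^n); rewrite mulr1 rmorphM !rmorphXn rmorphN1; split=> //.
  by rewrite !hornerE expr1n mulr1.
exists n.+1, ((-1) ^+ i); rewrite -mulrA mulVf ?expf_neq0 // mulr1 rmorphXn rmorphN1.
by split=> //; rewrite !hornerE.
Qed.

(* The value at t = 1 is an alternating sum of q ones. *)
Lemma alexander_tvar_neq0 (R : realType) p q : odd q -> alexander p q (@tvar R) != 0.
Proof.
move=> qodd; have q0 := odd_gt0 qodd.
have -> : alexander p q (@tvar R) = \sum_(0 <= i < q) (-1) ^+ i * tvar ^ eps_sum p q i.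
  by rewrite [RHS]big_ltn // eps_sum0 expr0 mulr1.
have [N [f [fE f1]]] := laurent_at1_sum R (index_iota 0 q) (eps_sum p q).
apply/eqP => x0; move: fE; rewrite x0 mul0r => /esym/eqP; rewrite fraction.tofrac_eq0 => /eqP f0.
move: f1; rewrite f0 horner0 => /esym/eqP; apply/negP.
have -> : q = (2 * (q.-1)./2).+1 by lia.
elim: _./2 => [|k IH]; first by rewrite big_nat1 oner_neq0.
by rewrite mulnS add2n big_nat_recr // big_nat_recr //= [(-1) ^+ (2 * k).+2]exprS mulN1r addrK.
Qed.

(** * Primitivity of the root of unity *)

Lemma de_moivre (R : realType) (x : R) n :
  ((cos x +i* sin x)%C : R[i]) ^+ n = (cos (x *+ n) +i* sin (x *+ n))%C.
Proof.
elim: n => [|n IH]; first by rewrite !mulr0n cos0 sin0.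
by rewrite exprS IH !mulrS cosD sinD; congr (_ +i* _)%C; rewrite addrC.
Qed.

(** The order divides the prime l, and it is not 1 because the imaginary part sin(2 pi / l) is
    positive for l > 2. *)
Lemma zeta_prim (R : realType) l : prime l -> odd l -> l.-primitive_root (zeta R l).
Proof.
move=> lp lodd; have l0 := prime_gt0 lp; have l1 := prime_gt1 lp.
have l2 : (2 < l)%N by case: l lp lodd l1 {l0} => [|[|[|]]].
have lR : (0 : R) < l%:R by rewrite ltr0n.
have zl : zeta R l ^+ l = 1.
  have E : 2 * pi / l%:R *+ l = pi *+ 2 :> R.
    by rewrite -[LHS]mulr_natr divfK ?gt_eqF // mulr_natl.
  rewrite /zeta -fraction.tofracXn -polyC_exp de_moivre E cos2pi sin2pi.
  have -> : (1 +i* 0)%C = 1 :> R[i] by [].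
  by rewrite polyC1 fraction.tofrac1.
have zn : zeta R l != 1.
  rewrite /zeta -fraction.tofrac1 fraction.tofrac_eq -polyC1 (inj_eq (@polyC_inj _)).
  rewrite eq_complex negb_and /=; apply/orP; right; rewrite gt_eqF // sin_gt0_pi //.
  rewrite divr_gt0 ?mulr_gt0 ?pi_gt0 //= ltr_pdivrMr // mulrC ltr_pM2l ?pi_gt0 //.
  by rewrite ltr_nat.
have [m prim ml] := prim_order_exists l0 zl.
have /orP[/eqP m1|/eqP ml'] := (primeP lp).2 m ml; last by rewrite ml' in prim.
by move: zn; rewrite -[zeta R l]expr1 -m1 (prim_expr_order prim) eqxx.
Qed.

Theorem theorem9 (R : realType) (p q a1 r1 l j p' q' : nat)
  (hp : (1 < p)%N) (hpq : (p < q)%N) (podd : odd p) (qodd : odd q)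
  (copq : coprime p q)
  (hq : q = (a1 * p + r1)%N) (hr0 : (0 < r1)%N) (hr : (r1 < p)%N)
  (lprime : prime l) (lodd : odd l) (lq : (l %| q)%N) (hj : (0 < j)%N)
  (hp' : p' = (p + 2 * l * j * r1)%N)
  (hq' : q' = (q + 2 * l * j * a1 * r1)%N) :
  (congr_mod l tvar (Delta R p' q') (Delta R p q) /\
   congr_mod l tvar (tDelta R l p' q') (tDelta R l p q)) /\
  (coprime a1 l ->
   (tDelta R l p' q' / Delta R p' q' = tDelta R l p q / Delta R p q)%R).
Proof.
(* If a1 were 0, then q = r1 < p, against p < q. *)
have a0 : (0 < a1)%N by case: a1 hq hq' => //; lia.
have q'odd : odd q' by rewrite hq' oddD qodd -!mulnA oddM.
have prim := zeta_prim R lprime lodd.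
have t0 : tvar != 0 :> ratfun R by rewrite fraction.tofrac_eq0 polyX_eq0.
have t1 : tvar - 1 != 0 :> ratfun R.
  by rewrite -fraction.tofrac1 -fraction.tofracB fraction.tofrac_eq0 -polyC1 polyXsubC_eq0.
have tN1 : tvar + 1 != 0 :> ratfun R.
  rewrite -fraction.tofrac1 -fraction.tofracD fraction.tofrac_eq0 -polyC1.
  by rewrite -size_poly_eq0 size_XaddC.
have lF : l%:R != 0 :> ratfun R.
  rewrite -fraction.tofrac1 -fraction.tofracMn fraction.tofrac_eq0 -polyC_natr polyC_eq0.
  by rewrite pnatr_eq0 -lt0n prime_gt0.
split=> [|cop].
  split; first exact: (alexander_congr t0 t1 tN1 a0 hq hr0 hr qodd hp' hq').
  exact: (twisted_alexander_congr t0 t1 tN1 lprime lodd lF a0 hq hr0 hr qodd hp' hq').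
apply: (twisted_alexander_ratio t0 t1 tN1 lprime lodd lF a0 hq hr0 hr qodd hp' hq' prim cop).
- exact: alexander_tvar_neq0.
- exact: alexander_tvar_neq0.
Qed.
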